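(* Let $(X,\triangleright)$ be a rack or a quandle with finitely many connected components. Then $(X,\triangleright)$ is unbounded if and only if the comparison map $H^2_b(X;\mathbb R)\to H^2(X;\mathbb R)$ has nontrivial kernel.
   Context: A rack is a non-empty set $X$ with a binary operation $\triangleright$ such that for every $x\in X$ the map $\psi_x(y)=x\triangleright y$ is a bijection of $X$, and $x\triangleright(y\triangleright z)=(x\triangleright y)\triangleright(x\triangleright z)$ for all $x,y,z$. It is a quandle if moreover $x\triangleright x=x$ for all $x$. The inner automorphism group $G_\psi$ is the group of bijections of $X$ generated by all $\psi_x$; the connected components of $X$ are the orbits of $G_\psi$. The rack metric on a connected component is $d(x,y)=\min\{n\in\mathbb N\mid y=(\psi_{x_1}^{\pm1}\circ\dots\circ\psi_{x_n}^{\pm1})(x)\text{ for some }x_i\in X\}$ ($n=0$ allowed). $(X,\triangleright)$ is bounded if the rack metric on each connected component has finite diameter; otherwise it is unbounded. The rack cochain complex $C^*(X;\mathbb R)$ has $C^k(X;\mathbb R)$ equal to the space of all functions $f\colon X^k\to\mathbb R$, with differential $$\delta f(x_1,\dots,x_{k+1})=\sum_{i=1}^k(-1)^{i-1}f(x_1,\dots,x_{i-1},x_{i+1},\dots,x_{k+1})-\sum_{i=1}^k(-1)^{i-1}f(x_1,\dots,x_{i-1},x_i\triangleright x_{i+1},\dots,x_i\triangleright x_{k+1}).$$ Its cohomology is the rack cohomology $H^*(X;\mathbb R)$; the cohomology of the subcomplex $C^*_b(X;\mathbb R)$ of bounded functions is the rack bounded cohomology $H^*_b(X;\mathbb R)$.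 If $(X,\triangleright)$ is a quandle, the quandle (bounded) cohomology is defined in the same way using the subcomplex of (bounded) functions $f\colon X^k\to\mathbb R$ with $f(x_1,\dots,x_k)=0$ whenever $x_i=x_{i+1}$ for some $i\in\{1,\dots,k-1\}$. The notation $H^*$, $H^*_b$ means rack cohomology when $(X,\triangleright)$ is considered as a rack, and quandle cohomology when it is considered as a quandle. The comparison map $H^*_b(X;\mathbb R)\to H^*(X;\mathbb R)$ is induced by the inclusion of the bounded subcomplex. *)

(* Defs.v *)
From HB Require Import structures.
From mathcomp Require Import all_boot all_order all_algebra.
From mathcomp Require Import all_classical all_reals all_analysis.
From mathcomp Require Import zify.
Import Order.TTheory GRing.Theory Num.Theory numFieldNormedType.Exports.
Set Implicit Arguments.
Unset Strict Implicit.
Unset Printing Implicit Defensive.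

Local Open Scope classical_set_scope.
Local Open Scope ring_scope.

HB.mixin Record isRack (X : Type) := {
  psi : X -> X -> X;
  rack_inhabited : inhabited X;
  psi_bij : forall x, bijective (psi x);
  psi_distr : forall x y z, psi x (psi y z) = psi (psi x y) (psi x z)
}.

#[short(type="rackType")]
HB.structure Definition Rack := {X of isRack X}.

HB.mixin Record Rack_isQuandle X of isRack X := {
  psi_idem : forall x : X, psi x x = x
}.

#[short(type="quandleType")]
HB.structure Definition Quandle := {X of isRack X & Rack_isQuandle X}.

Declare Scope rack_scope.
Delimit Scope rack_scope with rack.
Local Open Scope rack_scope.

Notation "x |> y" := (psi x y) (at level 40, left associativity) : rack_scope.

Section Metric.
Variable X : rackType.

Lemma psi_has_inv (x : X) : exists g, cancel (psi x) g /\ cancel g (psi x).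
Proof. by case: (psi_bij x) => g gK Kg; exists g. Qed.

Definition psi_inv (x : X) : X -> X := sval (cid (psi_has_inv x)).

Lemma psiK (x : X) : cancel (psi x) (psi_inv x).
Proof. by rewrite /psi_inv; case: cid => g []. Qed.

Lemma psiVK (x : X) : cancel (psi_inv x) (psi x).
Proof. by rewrite /psi_inv; case: cid => g []. Qed.

Inductive inner_aut : (X -> X) -> Prop :=
  | inner_aut_id : inner_aut id
  | inner_aut_psi x : inner_aut (psi x)
  | inner_aut_comp f g : inner_aut f -> inner_aut g -> inner_aut (f \o g)
  | inner_aut_inv f g :
      inner_aut f -> cancel f g -> cancel g f -> inner_aut g.

Definition component (x : X) : set X := [set g x | g in inner_aut].

Definition components : set (set X) := range component.

Definition psi_sign (e : bool) : X -> X -> X := if e then psi_inv else psi.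

(* [s] lists the pairs [(e_i, x_i)] in the order of the composition, so that
   the last entry acts first. *)
Definition psi_word (s : seq (bool * X)) : X -> X :=
  foldr (fun ex h => psi_sign ex.1 ex.2 \o h) id s.

Definition word_length (x y : X) : set nat :=
  [set n | exists2 s : seq (bool * X), size s = n & y = psi_word s x].

(* When [x] and [y] lie in different components [word_length x y] is empty and
   the distance takes the meaningless value [0]. *)
Definition rack_dist (x y : X) : nat :=
  xget 0%N [set n | word_length x y n /\
                    forall m, word_length x y m -> (n <= m)%N].

Definition rack_bounded : Prop :=
  forall C, components C ->
    exists N : nat, forall x y, C x -> C y -> (rack_dist x y <= N)%N.

Definition rack_unbounded : Prop := ~ rack_bounded.

Lemma component_word x y : component x y <-> exists n, word_length x y n.
Proof.
split=> [[g gI <-]|[n [s _ ->]]]; last first.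
  exists (psi_word s) => //; elim: s => [|[e a] s IH] /=.
    exact: inner_aut_id.
  apply: inner_aut_comp => //; case: e => /=; last exact: inner_aut_psi.
  exact: (inner_aut_inv (inner_aut_psi a) (@psiK a) (@psiVK a)).
suff [s ->] : exists s, g = psi_word s by exists (size s); exists s.
have wcat s t : psi_word (s ++ t) = psi_word s \o psi_word t.
  by elim: s => [|[e a] s IH] //=; rewrite IH.
elim: {x y} gI => [|x|f g' _ [s ->] _ [t ->]|f g' _ [s ->] fK gK].
- by exists [::].
- by exists [:: (false, x)].
- by exists (s ++ t).
suff [t tK] : exists t, cancel (psi_word t) (psi_word s).
  by exists t; apply/funext => z; rewrite -[in LHS](tK z) fK.
elim: s {fK gK g'} => [|[e a] s [t tK]]; first by exists [::].
exists (t ++ [:: (~~ e, a)]) => z; rewrite wcat /= tK.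
by case: e => /=; rewrite ?psiK ?psiVK.
Qed.

Lemma rack_distP x y : component x y ->
  word_length x y (rack_dist x y) /\
  forall m, word_length x y m -> (rack_dist x y <= m)%N.
Proof.
move=> /component_word [n xyn]; rewrite /rack_dist; case: xgetP => [_ _ //|no].
have ex : exists n, `[< word_length x y n >] by exists n; apply/asboolP.
have [m /asboolP xym mmin] := ex_minnP ex.
by case: (no m); split=> // p xyp; apply: mmin; apply/asboolP.
Qed.

End Metric.

Arguments components : clear implicits.
Arguments rack_bounded : clear implicits.
Arguments rack_unbounded : clear implicits.

Section Cochains.
Variables (R : realType) (X : rackType).

Definition cochain (k : nat) : lmodType R := (('I_k -> X) -> R^o)%type.

Definition face0 k (i : 'I_k.+1) (x : 'I_k.+1 -> X) : 'I_k -> X :=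
  fun j => x (lift i j).

Definition face1 k (i : 'I_k.+1) (x : 'I_k.+1 -> X) : 'I_k -> X :=
  fun j => if (j < i)%N then x (lift i j) else x i |> x (lift i j).

(* Indices start at [0] here, so the sign [(-1)^(i-1)] becomes [(-1)^i]; the
   last index of [x] is not among those summed over. *)
Definition delta k (f : cochain k) : cochain k.+1 := fun x =>
    \sum_(i < k) (-1) ^+ i *: f (face0 (widen_ord (leqnSn k) i) x)
  - \sum_(i < k) (-1) ^+ i *: f (face1 (widen_ord (leqnSn k) i) x).

Lemma delta_is_linear k : linear (@delta k).
Proof.
move=> a f g; apply/funext => x; rewrite /delta /= !fctE.
rewrite scalerBr !scaler_sumr addrACA -opprD -!big_split /=.
by congr (_ - _); apply: eq_bigr => i _; rewrite scalerDr !scalerA mulrC.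
Qed.

HB.instance Definition _ k :=
  GRing.isLinear.Build R (cochain k) (cochain k.+1) _ (@delta k)
    (@delta_is_linear k).

(* Including the last index changes nothing: its two faces coincide. *)
Lemma deltaE k (f : cochain k) x :
  delta f x = \sum_(i < k.+1) (-1) ^+ i *: (f (face0 i x) - f (face1 i x)).
Proof.
rewrite big_ord_recr /= [X in f X - _](_ : _ = face1 ord_max x); last first.
  by apply/funext => j; rewrite /face1 /= ltn_ord.
rewrite subrr scaler0 addr0 /delta -sumrB.
by apply: eq_bigr => i _; rewrite -scalerBr.
Qed.

Lemma lift_nat n (i : 'I_n.+1) (j : 'I_n) :
  lift i j = (if (j < i)%N then j : nat else j.+1) :> nat.
Proof. by rewrite /= /bump; case: (ltnP j i); lia. Qed.

Definition face (b : bool) k := if b then @face1 k else @face0 k.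

Lemma face_exchange a b k (x : 'I_k.+2 -> X)
    (i i' : 'I_k.+2) (j j' : 'I_k.+1) :
    lift i j = i' -> lift i' j' = i ->
  face a j (face b i x) = face b j' (face a i' x).
Proof.
wlog lt_ji : a b i i' j j' / (j < i)%N => [hw|] x21 x12.
  have [lt_ji|le_ij] := ltnP j i; first exact: hw.
  apply/esym/hw => //; have := lift_nat i j; have := lift_nat i' j'.
  by rewrite x12 x21; do ![case: ifP]; lia.
apply/funext => l; have e1 := lift_nat i j; have e2 := lift_nat i' j'.
rewrite x21 lt_ji in e1; rewrite x12 e1 in e2.
have lt_j'i' : (j' < i')%N = false by move: e2; case: ifP; lia.
have {}e2 : i = j'.+1 :> nat by move: e2; rewrite -e1 lt_j'i'.
have xx : lift i' (lift j' l) = lift i (lift j l).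
  by apply: ord_inj; rewrite !lift_nat e1 e2; do ![case: ifP]; lia.
have c1 : (lift j l < i)%N = (l < j')%N.
  by rewrite lift_nat e2; case: ifP; lia.
have c2 : (lift j' l < i')%N = (l < j)%N.
  by rewrite lift_nat e1; case: ifP; lia.
have c3 : (l < j)%N -> (l < j')%N by lia.
case: a; case: b; rewrite /face /face0 /face1 ?x21 ?x12 ?xx ?c1 ?c2 //.
rewrite lt_ji lt_j'i'.
case: (ltnP l j) c3 => [_ -> //|_ _]; case: ifP => // _.
by rewrite psi_distr.
Qed.

Lemma delta_delta k (f : cochain k) : delta (delta f) = 0.
Proof.
apply/funext => x.
pose h (p : 'I_k.+2 * 'I_k.+1) (ab : bool * bool) :=
  f (face ab.1 p.2 (face ab.2 p.1 x)).
pose E (p : 'I_k.+2 * 'I_k.+1) := (-1) ^+ (p.1 + p.2)%N *: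
  (h p (false, false) - h p (true, false)
   - (h p (false, true) - h p (true, true))) : R^o.
pose s (p : 'I_k.+2 * 'I_k.+1) : 'I_k.+2 * 'I_k.+1 :=
  (lift p.1 p.2, inord (if (p.2 < p.1)%N then p.1.-1 else p.1)).
have s2E p : (s p).2 = (if (p.2 < p.1)%N then p.1.-1 else p.1) :> nat.
  case: p => i j /=; rewrite inordK //.
  by have := ltn_ord i; have := ltn_ord j; case: ifP; lia.
have s1E p : (s p).1 = (if (p.2 < p.1)%N then p.2 : nat else p.2.+1) :> nat.
  by case: p => i j /=; rewrite /bump; case: (ltnP j i); lia.
have s12 p : lift (s p).1 (s p).2 = p.1.
  by apply: ord_inj; rewrite lift_nat s1E s2E; do ![case: ifP]; lia.
have sK : involutive s.
  move=> p; rewrite [LHS]surjective_pairing [RHS]surjective_pairing.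
  congr (_, _); apply: ord_inj.
    by rewrite s1E !s2E s1E; do ![case: ifP]; lia.
  by rewrite s2E !s1E s2E; do ![case: ifP]; lia.
have hs p a b : h (s p) (a, b) = h p (b, a).
  by rewrite /h (face_exchange b a x (erefl _) (s12 p)).
have Es p : E (s p) = - E p.
  rewrite /E !hs -scaleNr; congr (_ *: _); last first.
    by rewrite !opprB addrACA [RHS]addrACA; congr (_ + _); rewrite addrC.
  have -> : ((s p).1 + (s p).2 = if (p.2 < p.1)%N then (p.1 + p.2).-1
                               else (p.1 + p.2).+1)%N.
    by rewrite s1E s2E; case: ifP; lia.
  case: ifP => [lt|_]; last by rewrite exprS mulN1r.
  rewrite -[in RHS](@prednK (p.1 + p.2)) ?exprS ?mulN1r ?opprK //.
  by rewrite addn_gt0 (leq_ltn_trans _ lt).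
suff -> : delta (delta f) x = \sum_p E p.
  have : \sum_p E p = - \sum_p E p.
    rewrite {1}(reindex_inj (inv_inj sK)) -sumrN.
    by apply: eq_bigr => p _; rewrite Es.
  by move/eqP; rewrite -addr_eq0 -mulr2n mulrn_eq0 /= => /eqP.
rewrite deltaE -(pair_bigA _ (fun i j => E (i, j))) /=.
apply: eq_bigr => i _; rewrite !deltaE -sumrB scaler_sumr.
by apply: eq_bigr => j _; rewrite -scalerBr scalerA -exprD.
Qed.

End Cochains.

Arguments cochain : clear implicits.

Section Subcomplexes.
Variables (R : realType) (X : rackType).

Record subcomplex := Subcomplex {
  subcochain : forall k, set (cochain R X k);
  subcochain_submod : forall k,
    subcochain (0 : cochain R X k) /\
    forall a (f g : cochain R X k),
      subcochain f -> subcochain g -> subcochain (a *: f + g);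
  subcochain_delta : forall k (f : cochain R X k),
    subcochain f -> subcochain (delta f)
}.

Arguments subcochain : clear implicits.

Lemma bounded_cochainP k (f : cochain R X k) :
  bounded_fun f <-> exists M : R, forall x, `|f x| <= M.
Proof.
split=> [/pinfty_ex_gt0 [M _ fM]|[M fM]]; first by exists M => x; exact: fM.
by exists M; split; [exact: num_real|move=> N /ltW MN x _; exact: le_trans MN].
Qed.

Lemma rack_submod k :
  [set: cochain R X k] 0 /\
  forall a (f g : cochain R X k), setT f -> setT g -> setT (a *: f + g).
Proof. by []. Qed.

Definition rack_complex : subcomplex :=
  @Subcomplex (fun=> setT) rack_submod (fun _ _ _ => I).

Definition bounded_cochain k : set (cochain R X k) :=
  [set f | bounded_fun f].

Lemma bounded_submod k :
  bounded_cochain (0 : cochain R X k) /\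
  forall a (f g : cochain R X k),
    bounded_cochain f -> bounded_cochain g -> bounded_cochain (a *: f + g).
Proof.
split=> [|a f g].
  by apply/bounded_cochainP; exists 0 => x; rewrite normr0.
move=> /bounded_cochainP [M fM] /bounded_cochainP [N gN].
apply/bounded_cochainP; exists (`|a| * M + N) => x.
rewrite (le_trans (ler_normD _ _))// lerD// normrM.
by rewrite ler_wpM2l.
Qed.

Lemma bounded_delta k (f : cochain R X k) :
  bounded_cochain f -> bounded_cochain (delta f).
Proof.
move=> /bounded_cochainP [M fM].
apply/bounded_cochainP; exists (\sum_(i < k.+1) (M + M)) => x.
rewrite deltaE (le_trans (ler_norm_sum _ _ _))// ler_sum// => i _.
rewrite normrM normrX normrN1 expr1n mul1r.
by rewrite (le_trans (ler_normB _ _))// lerD.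
Qed.

Definition bounded_complex : subcomplex :=
  Subcomplex bounded_submod bounded_delta.

Section Intersection.
Variables S T : subcomplex.

Let STI k := subcochain S k `&` subcochain T k.

Lemma subcomplexI_submod k :
  STI (0 : cochain R X k) /\
  forall a (f g : cochain R X k), STI f -> STI g -> STI (a *: f + g).
Proof.
have [S0 SP] := subcochain_submod S k; have [T0 TP] := subcochain_submod T k.
by split=> // a f g [? ?] [? ?]; split; [exact: SP|exact: TP].
Qed.

Lemma subcomplexI_delta k (f : cochain R X k) : STI f -> STI (delta f).
Proof. by move=> [? ?]; split; exact: subcochain_delta. Qed.

Definition subcomplexI : subcomplex :=
  @Subcomplex (fun k => subcochain S k `&` subcochain T k)
    subcomplexI_submod subcomplexI_delta.

End Intersection.

Definition degenerate k (x : 'I_k -> X) : Prop :=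
  exists i j : 'I_k, j = i.+1 :> nat /\ x i = x j.

Definition quandle_cochain k : set (cochain R X k) :=
  [set f | forall x, degenerate x -> f x = 0].

End Subcomplexes.

Arguments subcochain {R X} _ k _.
Arguments rack_complex : clear implicits.
Arguments bounded_complex : clear implicits.

Section QuandleComplex.
Variables (R : realType) (X : quandleType).

Lemma degenerate_face b k (x : 'I_k.+1 -> X) (i j m : 'I_k.+1) :
    j = i.+1 :> nat -> x i = x j -> m != i -> m != j ->
  degenerate (face b m x).
Proof.
move=> ji xij mi mj.
have [i' i'E] : exists i' : 'I_k, i = lift m i'.
  by case: (unlift_some mi) => i'; exists i'.
have [j' j'E] : exists j' : 'I_k, j = lift m j'.
  by case: (unlift_some mj) => j'; exists j'.
have := lift_nat m i'; have := lift_nat m j'; rewrite -i'E -j'E => ej ei.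
have lt_m : (j' < m)%N = (i' < m)%N.
  by move: ei ej; rewrite ji; case: (ltnP j' m); case: (ltnP i' m); lia.
exists i', j'; split.
  by move: ei ej; rewrite ji lt_m; case: ifP => _ -> //; lia.
by case: b; rewrite /face /face0 /face1 -?i'E -?j'E ?lt_m xij.
Qed.

Lemma quandle_cochain_delta k (f : cochain R X k) :
  quandle_cochain f -> quandle_cochain (delta f).
Proof.
move=> f0 x [i [j [ji xij]]]; rewrite deltaE.
have ij : j != i by rewrite -val_eqE /= ji; lia.
rewrite (bigD1 i)//= (bigD1 j)//= [X in _ + (_ + X)]big1 => [|m /andP[mi mj]].
  rewrite addr0 ji exprS mulN1r scaleNr.
  have eface b : face b i x = face b j x.
    have lij (l : 'I_k) : l = i :> nat -> lift i l = j /\ lift j l = i.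
      move=> li; split; apply: ord_inj; rewrite lift_nat ji li ?ltnn//.
      by rewrite ltnS leqnn.
    have lNij (l : 'I_k) : l <> i :> nat -> lift i l = lift j l.
      by move=> li; apply: ord_inj; rewrite !lift_nat; do ![case: ifP]; lia.
    apply/funext => l; have [li|/eqP li] := eqVneq (l : nat) i.
      have [lij1 lij2] := lij l li; case: b; rewrite /face /face0 /face1 lij1 lij2.
        by rewrite li ji ltnn ltnS leqnn -xij psi_idem.
      by rewrite xij.
    case: b; rewrite /face /face0 /face1 lNij//.
    by rewrite (_ : (l < j)%N = (l < i)%N) ?xij//; move: li; rewrite ji; lia.
  have := eface false; have := eface true; rewrite /face => -> ->.
  by rewrite subrr.
have fx0 b := f0 _ (degenerate_face b ji xij mi mj).
have := fx0 false; have := fx0 true; rewrite /face => -> ->.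
by rewrite subrr scaler0.
Qed.

Lemma quandle_submod k :
  quandle_cochain (0 : cochain R X k) /\
  forall a (f g : cochain R X k),
    quandle_cochain f -> quandle_cochain g -> quandle_cochain (a *: f + g).
Proof.
split=> [//|a f g f0 g0 x x0].
by rewrite !fctE f0// g0// scaler0 addr0.
Qed.

Definition quandle_complex : subcomplex R X :=
  Subcomplex quandle_submod quandle_cochain_delta.

End QuandleComplex.

Arguments quandle_complex : clear implicits.

Section Cohomology.
Variables (R : realType) (X : rackType) (S : subcomplex R X) (k : nat).

Definition is_cocycle : {pred cochain R X k} :=
  mem [set f : cochain R X k | subcochain S k f /\ delta f = 0].

Lemma is_cocycleP f :
  reflect (subcochain S k f /\ delta f = 0) (f \in is_cocycle).
Proof. exact: asboolP. Qed.

Lemma is_cocycle_submod : submod_closed is_cocycle.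
Proof.
have [S0 SP] := subcochain_submod S k.
split=> [|a f g /is_cocycleP[Sf df] /is_cocycleP[Sg dg]].
  by apply/is_cocycleP; rewrite linear0.
by apply/is_cocycleP; rewrite delta_is_linear df dg scaler0 addr0; split=> //; exact: SP.
Qed.

HB.instance Definition _ :=
  GRing.isSubmodClosed.Build R (cochain R X k) is_cocycle is_cocycle_submod.

Record cocycle := Cocycle {
  cocycle_val :> cochain R X k;
  cocycleP : cocycle_val \in is_cocycle
}.

HB.instance Definition _ := [isSub for cocycle_val].
HB.instance Definition _ := [Choice of cocycle by <:].
HB.instance Definition _ := [SubChoice_isSubLmodule of cocycle by <:].

End Cohomology.

Section Cohomology.
Variables (R : realType) (X : rackType) (S : subcomplex R X).

Definition is_coboundary (k : nat) : {pred cocycle S k} :=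
  match k with
  | 0 => mem [set z : cocycle S 0 | z = 0]
  | k'.+1 => mem [set z : cocycle S k'.+1 |
                   exists2 g, subcochain S k' g & cocycle_val z = delta g]
  end.

Lemma is_coboundary_submod k : submod_closed (@is_coboundary k).
Proof.
case: k => [|k]; split=> [|a y z].
- exact/asboolP.
- by move=> /asboolP -> /asboolP ->; apply/asboolP; rewrite scaler0 addr0.
- have [S0 _] := subcochain_submod S k.
  by apply/asboolP; exists 0 => //; rewrite linear0.
- have [_ SP] := subcochain_submod S k.
  move=> /asboolP[f Sf yf] /asboolP[g Sg zg]; apply/asboolP.
  exists (a *: f + g); first exact: SP.
  by rewrite delta_is_linear -yf -zg.
Qed.

HB.instance Definition _ k :=
  GRing.isSubmodClosed.Build R (cocycle S k) (@is_coboundary k)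
    (@is_coboundary_submod k).

Definition cohomology (k : nat) : Type := Quotient.quot (@is_coboundary k).

HB.instance Definition _ k := GRing.Zmodule.on (cohomology k).
HB.instance Definition _ k := EqQuotient.on (cohomology k).

Local Open Scope quotient_scope.

Definition cohomology_class k (z : cocycle S k) : cohomology k :=
  \pi_(cohomology k) z.

Lemma cohomology_classP k (y z : cocycle S k) :
  cohomology_class y = cohomology_class z <-> y - z \in @is_coboundary k.
Proof. by rewrite Quotient.idealrBE; split=> [/eqP|/eqP]. Qed.

Lemma cohomology_class_repr k (c : cohomology k) :
  cohomology_class (repr c) = c.
Proof. exact: reprK. Qed.

Lemma cohomology_classD k (y z : cocycle S k) :
  cohomology_class (y + z) = cohomology_class y + cohomology_class z.
Proof. exact: pi_addr. Qed.

Definition cohomology_scale k (a : R) (c : cohomology k) : cohomology k :=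
  cohomology_class (a *: repr c).

Lemma cohomology_scaleE k a (z : cocycle S k) :
  cohomology_scale a (cohomology_class z) = cohomology_class (a *: z).
Proof.
apply/cohomology_classP; rewrite -scalerBr; apply: rpredZ.
by apply/cohomology_classP; rewrite cohomology_class_repr.
Qed.

Section Scale.
Variable k : nat.

Fact cohomology_scalerA a b (c : cohomology k) :
  cohomology_scale a (cohomology_scale b c) = cohomology_scale (a * b) c.
Proof. by rewrite -[c]cohomology_class_repr !cohomology_scaleE scalerA. Qed.

Fact cohomology_scale1r : left_id 1 (@cohomology_scale k).
Proof.
by move=> c; rewrite -[c]cohomology_class_repr cohomology_scaleE scale1r.
Qed.

Fact cohomology_scalerDr : right_distributive (@cohomology_scale k) +%R.
Proof.
move=> a c d; rewrite -[c]cohomology_class_repr -[d]cohomology_class_repr.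
by rewrite -cohomology_classD !cohomology_scaleE scalerDr cohomology_classD.
Qed.

Fact cohomology_scalerDl (c : cohomology k) :
  {morph (@cohomology_scale k)^~ c : a b / a + b}.
Proof.
move=> a b; rewrite -[c]cohomology_class_repr !cohomology_scaleE scalerDl.
exact: cohomology_classD.
Qed.

HB.instance Definition _ := GRing.Zmodule_isLmodule.Build R (cohomology k)
  cohomology_scalerA cohomology_scale1r cohomology_scalerDr
  cohomology_scalerDl.

Fact cohomology_class_is_linear : linear (@cohomology_class k).
Proof. by move=> a y z; rewrite cohomology_classD -cohomology_scaleE. Qed.

HB.instance Definition _ :=
  GRing.isLinear.Build R (cocycle S k) (cohomology k) _ (@cohomology_class k)
    cohomology_class_is_linear.

End Scale.

End Cohomology.

Section Inclusion.
Variables (R : realType) (X : rackType) (S T : subcomplex R X).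
Hypothesis ST : forall k, subcochain S k `<=` subcochain T k.

Lemma cocycle_incl_subproof k (z : cocycle S k) :
  cocycle_val z \in @is_cocycle R X T k.
Proof.
by have /is_cocycleP[Sz dz] := cocycleP z; apply/is_cocycleP; split=> //; exact: ST.
Qed.

Definition cocycle_incl k (z : cocycle S k) : cocycle T k :=
  Cocycle (cocycle_incl_subproof z).

(* The choice of the representative is irrelevant: see [cohomology_inclE]. *)
Definition cohomology_incl k (c : cohomology S k) : cohomology T k :=
  cohomology_class (cocycle_incl (repr c)).

Lemma cohomology_inclE k (z : cocycle S k) :
  cohomology_incl (cohomology_class z) = cohomology_class (cocycle_incl z).
Proof.
have : repr (cohomology_class z) - z \in @is_coboundary R X S k.
  by apply/cohomology_classP; rewrite cohomology_class_repr.
rewrite /cohomology_incl; move: (repr _) => y yz; apply/cohomology_classP.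
case: k z y yz => [|k] z y /asboolP.
  by move=> /(congr1 val)/= yz; apply/asboolP/val_inj.
by move=> [g Sg yz]; apply/asboolP; exists g => //; exact: ST.
Qed.

Fact cohomology_incl_is_linear k : linear (@cohomology_incl k).
Proof.
move=> a c d; rewrite -[c]cohomology_class_repr -[d]cohomology_class_repr.
rewrite -linearP !cohomology_inclE -linearP; congr cohomology_class.
exact: val_inj.
Qed.

HB.instance Definition _ k := GRing.isLinear.Build R (cohomology S k)
  (cohomology T k) _ (@cohomology_incl k) (@cohomology_incl_is_linear k).

End Inclusion.

Section Comparison.
Variables (R : realType) (X : rackType).

Definition bounded_part (S : subcomplex R X) : subcomplex R X :=
  subcomplexI S (bounded_complex R X).

Lemma bounded_part_sub (S : subcomplex R X) k :
  subcochain (bounded_part S) k `<=` subcochain S k.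
Proof. by move=> f []. Qed.

Definition comparison (S : subcomplex R X) (k : nat) :
    {linear cohomology (bounded_part S) k -> cohomology S k} :=
  @cohomology_incl R X _ _ (@bounded_part_sub S) k.

End Comparison.

Definition nontrivial_kernel (R : pzRingType) (U V : lmodType R)
  (f : {linear U -> V}) : Prop := exists2 u, u != 0 & f u = 0.

(* Main.v *)
(* A class in the kernel of the comparison map is [delta f] for a function [f]
   on [X] with [delta f] bounded, that is, Lipschitz for the rack metric; it
   vanishes iff [f] differs from a bounded function by one that is constant on
   components. If a component is unbounded, the distance to a base point in it
   is Lipschitz but not of this form. If there are finitely many components, all
   bounded, subtracting from a Lipschitz function its value at a base point of
   each component leaves a bounded function. *)
Require Import Defs.
From HB Require Import structures.
From mathcomp Require Import all_boot all_order all_algebra.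
From mathcomp Require Import all_classical all_reals all_analysis.
From mathcomp Require Import lra.
Import Order.TTheory GRing.Theory Num.Theory.
Set Implicit Arguments.
Unset Strict Implicit.
Unset Printing Implicit Defensive.

Local Open Scope classical_set_scope.
Local Open Scope ring_scope.
Local Open Scope rack_scope.

(** * Words and the rack metric on a component *)

Section RackMetric.
Variable X : rackType.
Implicit Types (x y z a : X) (s : seq (bool * X)).

Lemma psi_word_cat s1 s2 : psi_word (s1 ++ s2) = psi_word s1 \o psi_word s2.
Proof. by elim: s1 => [|[e a] s IH] //=; rewrite IH. Qed.

(** Reversing the word and flipping every sign inverts it; as the length is kept, the rack metric is
    symmetric. *)
Lemma psi_word_inverse s :
  exists2 t, size t = size s & cancel (psi_word s) (psi_word t).
Proof.
elim: s => [|[e a] s [t st tK]]; first by exists [::].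
exists (rcons t (~~ e, a)); first by rewrite size_rcons st.
move=> x; rewrite -cats1 psi_word_cat /=.
by case: e => /=; rewrite ?psiK ?psiVK tK.
Qed.

Lemma word_length0 x : word_length x x 0.
Proof. by exists [::]. Qed.

Lemma word_length_psi a x : word_length x (a |> x) 1.
Proof. by exists [:: (false, a)]. Qed.

Lemma word_length_sym x y n : word_length x y n -> word_length y x n.
Proof.
move=> [s sn ->]; have [t st tK] := psi_word_inverse s.
by exists t; rewrite ?st ?tK.
Qed.

Lemma word_length_trans y x z m n :
  word_length x y m -> word_length y z n -> word_length x z (m + n).
Proof.
move=> [s <- ->] [t <- ->]; exists (t ++ s); first by rewrite size_cat addnC.
by rewrite psi_word_cat.
Qed.

Lemma component_refl x : component x x.
Proof. by apply/component_word; exists 0%N; exact: word_length0. Qed.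

Lemma component_sym x y : component x y -> component y x.
Proof.
move=> /component_word[n xy]; apply/component_word.
by exists n; exact: word_length_sym.
Qed.

Lemma component_trans y x z : component x y -> component y z -> component x z.
Proof.
move=> /component_word[m xy] /component_word[n yz]; apply/component_word.
by exists (m + n)%N; exact: word_length_trans yz.
Qed.

Lemma component_psi a x : component x (a |> x).
Proof. by apply/component_word; exists 1%N; exact: word_length_psi. Qed.

Lemma component_eq x y : component x y -> component x = component y.
Proof.
move=> xy; apply/seteqP; split=> z; last exact: component_trans.
exact/component_trans/component_sym.
Qed.

Lemma rack_dist_le x y n : word_length x y n -> (rack_dist x y <= n)%N.
Proof.
by move=> xyn; apply: (rack_distP _).2 => //; apply/component_word; exists n.
Qed.

Lemma rack_dist_triangle y x z : component x y -> component y z ->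
  (rack_dist x z <= rack_dist x y + rack_dist y z)%N.
Proof.
move=> xy yz; apply: rack_dist_le.
exact: word_length_trans (rack_distP xy).1 (rack_distP yz).1.
Qed.

Lemma rack_distC x y : component x y -> rack_dist x y = rack_dist y x.
Proof.
move=> xy; have yx := component_sym xy.
by apply/eqP; rewrite eqn_leq !rack_dist_le//;
  apply: word_length_sym; exact: (rack_distP _).1.
Qed.

Lemma rack_dist_psi a x : (rack_dist x (a |> x) <= 1)%N.
Proof. exact/rack_dist_le/word_length_psi. Qed.

End RackMetric.

(** * Lipschitz functions for the rack metric *)

Section Lipschitz.
Variables (R : realType) (X : rackType) (h : X -> R) (M : R).
Hypothesis hM : forall a y, `|h (a |> y) - h y| <= M.

Lemma lipschitz_word s x : `|h (psi_word s x) - h x| <= M *+ size s.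
Proof.
elim: s => [|[e a] s IH] /=; first by rewrite subrr normr0.
rewrite mulrS (le_trans (ler_distD (h (psi_word s x)) _ _))// lerD//.
case: e; last exact: hM.
(* For an inverse letter, [hM] is applied at the image under [psi_inv a], which [psi a] sends back
   to the point. *)
by rewrite distrC -{1}(psiVK a (psi_word s x)); exact: hM.
Qed.

Lemma lipschitz_rack_dist x y :
  component x y -> `|h y - h x| <= M *+ rack_dist x y.
Proof. by move=> /rack_distP[[s <- ->] _]; exact: lipschitz_word. Qed.

End Lipschitz.

(** * One-cochains and the kernel in degree two *)

Section Comparison2.
Variables (R : realType) (X : rackType).

Definition cochain1 (h : X -> R) : cochain R X 1 := fun x => h (x ord0).

Lemma cochain1_surj (f : cochain R X 1) : f = cochain1 (fun y => f (fun=> y)).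
Proof.
by apply/funext => x; rewrite /cochain1; congr f; apply/funext => i; rewrite ord1.
Qed.

Lemma delta_cochain1 h x :
  delta (cochain1 h) x = h (x ord_max) - h (x ord0 |> x ord_max).
Proof.
rewrite /delta !big_ord1 expr0 !scale1r /cochain1 /face0 /face1 /=.
have -> : widen_ord (leqnSn 1) ord0 = ord0 :> 'I_2 by exact: val_inj.
by have -> : lift ord0 ord0 = ord_max :> 'I_2 by exact: val_inj.
Qed.

Lemma delta_cochain1_psi h a y :
  delta (cochain1 h) (fun i => if i == ord0 then a else y) = h y - h (a |> y).
Proof. by rewrite delta_cochain1. Qed.

Lemma bounded_delta_cochain1 h : bounded_cochain (delta (cochain1 h)) <->
  exists M, forall a y, `|h (a |> y) - h y| <= M.
Proof.
split=> [/bounded_cochainP[M hM]|[M hM]].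
  by exists M => a y; rewrite distrC -delta_cochain1_psi.
by apply/bounded_cochainP; exists M => x; rewrite delta_cochain1 distrC.
Qed.

(** Equal coboundaries mean that [h - g] is invariant under every [psi a], hence Lipschitz with
    constant 0 and so constant on components. *)
Lemma delta_cochain1_eq h g : delta (cochain1 h) = delta (cochain1 g) <->
  forall x y, component x y -> h y - g y = h x - g x.
Proof.
split=> [hg x y xy|hg].
  suff h0 a z : `|(h (a |> z) - g (a |> z)) - (h z - g z)| <= 0.
    have := @lipschitz_rack_dist R X (fun z => h z - g z) 0 h0 x y xy.
    by rewrite mul0rn normr_le0 subr_eq0 => /eqP.
  have := congr1 (fun f => f (fun i => if i == ord0 then a else z)) hg.
  by rewrite !delta_cochain1_psi normr_le0 => hz; apply/eqP; lra.
apply/funext => x; rewrite !delta_cochain1.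
by have := hg _ _ (component_psi (x ord0) (x ord_max)); lra.
Qed.

Lemma comparison_class (S : subcomplex R X) k (z : cocycle (bounded_part S) k) :
  comparison S k (cohomology_class z) =
  cohomology_class (cocycle_incl (@bounded_part_sub R X S) z).
Proof. exact: cohomology_inclE. Qed.

(** Since [S] contains every 1-cochain, [S] and its bounded part differ in degree 1 only by
    boundedness: the class of [delta (cochain1 h)] is zero in the bounded part exactly when some
    bounded [g] has the same coboundary. This form covers racks and quandles at once. *)
Lemma comparison2_kernel (S : subcomplex R X) :
    (forall f, subcochain S 1 f) ->
  nontrivial_kernel (comparison S 2) <->
  exists2 h : X -> R, exists M, forall a y, `|h (a |> y) - h y| <= M &
    forall g : X -> R, (exists M, forall y, `|g y| <= M) ->
      ~ (forall x y, component x y -> h y - g y = h x - g x).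
Proof.
move=> S1; split=> [[u u0 fu]|[h hM hg]].
  rewrite -[u]cohomology_class_repr in u0 fu; move: (repr u) u0 fu => z z0.
  rewrite comparison_class -(linear0 (@cohomology_class R X S 2)).
  move=> /cohomology_classP; rewrite subr0 => /asboolP[f _ /= zf].
  rewrite [f]cochain1_surj in zf; move: (fun y => _) zf => h zh.
  have /is_cocycleP[[_ zb] _] := cocycleP z.
  exists h; first by apply/bounded_delta_cochain1; rewrite -zh.
  move=> g [M gM] /delta_cochain1_eq hg; move/eqP: z0; apply.
  rewrite -(linear0 (@cohomology_class R X _ 2)).
  apply/cohomology_classP; rewrite subr0; apply/asboolP.
  exists (cochain1 g); last by rewrite zh.
  by split; [exact: S1|apply/bounded_cochainP; exists M => x; exact: gM].
(* Although [h] may be unbounded, its coboundary is bounded and thus a cocycle of the bounded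
   part. *)
have zP : delta (cochain1 h) \in @is_cocycle R X (bounded_part S) 2.
  apply/is_cocycleP; split; last exact: delta_delta.
  by split; [exact/subcochain_delta/S1|exact/bounded_delta_cochain1].
exists (cohomology_class (Cocycle zP)).
  apply/eqP; rewrite -(linear0 (@cohomology_class R X _ 2)).
  move=> /cohomology_classP; rewrite subr0 => /asboolP[f [_ fb] /=].
  rewrite [f]cochain1_surj => /delta_cochain1_eq; apply: hg.
  by have /bounded_cochainP[M fM] := fb; exists M => y; exact: fM.
rewrite comparison_class -(linear0 (@cohomology_class R X S 2)).
apply/cohomology_classP; rewrite subr0; apply/asboolP.
by exists (cochain1 h); first exact: S1.
Qed.

Lemma unbounded_comparison2_kernel (S : subcomplex R X) :
    (forall f, subcochain S 1 f) ->
  rack_unbounded X -> nontrivial_kernel (comparison S 2).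
Proof.
move=> S1 /existsNP[C /not_implyP[[x0 _ <-] /forallNP unb]].
apply/(comparison2_kernel S1).
(* The action preserves components, so extending the distance by 0 off the component of [x0] keeps
   it Lipschitz. *)
pose h y : R := if `[< component x0 y >] then (rack_dist x0 y)%:R else 0.
have hE y : component x0 y -> h y = (rack_dist x0 y)%:R.
  by move=> x0y; rewrite /h asboolT.
exists h.
  exists 1 => a y; have yay := component_psi a y.
  have [x0y|x0y] := pselect (component x0 y); last first.
    rewrite /h !asboolF ?subrr ?normr0//.
    by apply: contra_not x0y => /component_trans; apply; exact: component_sym.
  have x0ay := component_trans x0y yay.
  rewrite !hE// ler_distl lerBlDr !natr1 !ler_nat.
  have le1 := rack_dist_psi a y.
  apply/andP; split.
    apply: leq_trans (rack_dist_triangle x0ay (component_sym yay)) _.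
    by rewrite -(rack_distC yay) -addn1 leq_add2l.
  by apply: leq_trans (rack_dist_triangle x0y yay) _; rewrite -addn1 leq_add2l.
move=> g [M gM] hg.
(* On the component of [x0], [h] equals [g + (h x0 - g x0)], which is bounded; so the component has
   finite radius around [x0]. *)
have bh y : component x0 y -> (rack_dist x0 y <= Num.bound (M + (h x0 + M)))%N.
  move=> x0y; rewrite -(ler_nat R) -hE//.
  have -> : h y = g y + (h x0 - g x0) by rewrite -(hg _ _ x0y) addrC subrK.
  have hle : g y + (h x0 - g x0) <= M + (h x0 + M).
    have := gM y; have := gM x0; rewrite !ler_norml => /andP[? ?] /andP[? ?].
    lra.
  apply: (le_trans hle); apply: ltW; apply: archi_boundP.
  by rewrite !addr_ge0 ?(le_trans _ (gM x0))// /h; case: ifP.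
(* Through [x0], the diameter is at most twice the radius. *)
apply: (unb (Num.bound (M + (h x0 + M)) + Num.bound (M + (h x0 + M)))%N).
move=> x y x0x x0y.
apply: leq_trans (rack_dist_triangle (component_sym x0x) x0y) _.
by rewrite -(rack_distC x0x) leq_add ?bh.
Qed.

(** Finitely many components have a largest diameter bound; this is where finiteness enters. *)
Lemma bounded_uniform : finite_set (components X) -> rack_bounded X ->
  exists N : nat, forall x y : X, component x y -> (rack_dist x y <= N)%N.
Proof.
move=> /finite_seqP[s sE] bX.
have /choice[N NP] : forall C, exists n : nat, components X C ->
    forall x y, C x -> C y -> (rack_dist x y <= n)%N.
  move=> C; have [/bX[n nP]|nC] := pselect (components X C); first by exists n.
  by exists 0%N.
exists (\max_(C <- s) N C) => x y xy.
have xC : components X (component x) by exists x.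
apply: leq_trans (NP _ xC x y (component_refl x) xy) _.
by apply: leq_bigmax_seq => //; move: xC; rewrite sE.
Qed.

Lemma comparison2_kernel_unbounded (S : subcomplex R X) :
    (forall f, subcochain S 1 f) -> finite_set (components X) ->
  nontrivial_kernel (comparison S 2) -> rack_unbounded X.
Proof.
move=> S1 fin /(comparison2_kernel S1)[h [M hM] hg].
move=> /(bounded_uniform fin)[N NP].
have [x0] := rack_inhabited (s := X).
(* The base point is chosen from the component as a set, so that all its points share it; [x0] is
   the default for an empty [C]. *)
have /choice[r rP] : forall C : set X, exists x, forall y, C y -> C x.
  by move=> C; have [[x Cx]|/forallNP nC] := pselect (exists x, C x);
    [exists x|exists x0 => y /nC].
have ry y : component (r (component y)) y.
  exact/component_sym/(rP _ y)/component_refl.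
apply: (hg (fun y => h y - h (r (component y)))); last first.
  by move=> x y xy; rewrite !subKr (component_eq xy).
exists (M *+ N) => y; apply: le_trans (lipschitz_rack_dist hM (ry y)) _.
(* Monotonicity in the distance requires [0 <= M], which holds because [M] bounds an absolute
   value. *)
by rewrite ler_wpMn2l ?NP//; exact: le_trans (hM x0 x0).
Qed.

Lemma unbounded_iff_comparison2_kernel (S : subcomplex R X) :
    (forall f, subcochain S 1 f) -> finite_set (components X) ->
  rack_unbounded X <-> nontrivial_kernel (comparison S 2).
Proof.
move=> S1 fin; split; first exact: unbounded_comparison2_kernel.
exact: comparison2_kernel_unbounded.
Qed.

End Comparison2.

Theorem theorem1p2 (R : realType) :
  (forall X : rackType, finite_set (components X) ->
     (rack_unbounded X <->
      nontrivial_kernel (comparison (rack_complex R X) 2)))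
  /\
  (forall X : quandleType, finite_set (components X) ->
     (rack_unbounded X <->
      nontrivial_kernel (comparison (quandle_complex R X) 2))).
Proof.
split=> X fin; apply: unbounded_iff_comparison2_kernel => // f x.
(* A single argument leaves no pair of consecutive indices, so every 1-cochain is a quandle
   cochain. *)
by move=> [i [j [ji _]]]; rewrite !ord1 in ji.
Qed.
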